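(* Let $\mathcal X,\mathcal Y,\mathcal Z$ be finite-dimensional real Euclidean spaces, $f:\mathcal Y\to(-\infty,+\infty]$ and $g:\mathcal Z\to(-\infty,+\infty]$ closed proper convex functions, $\mathcal A:\mathcal X\to\mathcal Y$ and $\mathcal B:\mathcal X\to\mathcal Z$ linear maps with adjoints $\mathcal A^*,\mathcal B^*$, $c\in\mathcal X$, $\sigma>0$, and let $\mathcal S:\mathcal Y\to\mathcal Y$, $\mathcal T:\mathcal Z\to\mathcal Z$ be self-adjoint positive semidefinite linear operators. Let $(x',y',z')\in\mathcal X\times\operatorname{dom} f\times\operatorname{dom} g$ be arbitrary, and consider the problems $$(\mathrm{P}_y)\quad \min_{y\in\mathcal Y}\{\mathcal L_\sigma(y,z';x')+\tfrac12\|y-y'\|_{\mathcal S}^2\},\qquad (\mathrm{P}_z)\quad \min_{z\in\mathcal Z}\{\mathcal L_\sigma(y',z;x')+\tfrac12\|z-z'\|_{\mathcal T}^2\}.$$ Then: (a) Problem $(\mathrm P_y)$ is solvable (has a minimizer) if $f0^+(y)>0$ for every $y\in\mathcal M$, and problem $(\mathrm P_z)$ is solvable if $g0^+(z)>0$ for every $z\in\mathcal N$, where $$\mathcal M:=\{y\in\mathcal Y:\mathcal A^*y=0,\ \mathcal S y=0\}\setminus\{y\in\mathcal Y:f0^+(-y)=-f0^+(y)=0\},$$ $$\mathcal N:=\{z\in\mathcal Z:\mathcal B^*z=0,\ \mathcal T z=0\}\setminus\{z\in\mathcal Z:g0^+(-z)=-g0^+(z)=0\}.$$ (b) The solution set of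 $(\mathrm P_y)$ is nonempty and bounded if and only if $f0^+(y)>0$ for every nonzero $y\in\mathcal Y$ with $\mathcal A^*y=0$ and $\mathcal S y=0$; and the solution set of $(\mathrm P_z)$ is nonempty and bounded if and only if $g0^+(z)>0$ for every nonzero $z\in\mathcal Z$ with $\mathcal B^*z=0$ and $\mathcal T z=0$.
   Context: The augmented Lagrangian is $\mathcal L_\sigma(y,z;x):=f(y)+g(z)+\langle x,\mathcal A^*y+\mathcal B^*z-c\rangle+\tfrac\sigma2\|\mathcal A^*y+\mathcal B^*z-c\|^2$. For a self-adjoint positive semidefinite $\mathcal O$, $\|u\|_{\mathcal O}:=\sqrt{\langle u,\mathcal O u\rangle}$. $\operatorname{dom}$ denotes the effective domain. For a closed proper convex function $\theta$, its recession function is $\theta0^+(u):=\lim_{\rho\to+\infty}\frac{\theta(u'+\rho u)-\theta(u')}{\rho}$ for an arbitrary $u'\in\operatorname{dom}\theta$ (the value does not depend on $u'$). *)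

(* Defs.v *)
From HB Require Import structures.
From mathcomp Require Import all_boot all_order all_algebra.
From mathcomp Require Import ring.
From mathcomp Require Import all_classical all_reals all_analysis.

Set Implicit Arguments.
Unset Strict Implicit.
Unset Printing Implicit Defensive.

Import Order.TTheory GRing.Theory Num.Theory.
Import numFieldNormedType.Exports.

Local Open Scope classical_set_scope.
Local Open Scope ring_scope.

(* Finite-dimensional real inner product spaces: the norm, hence the topology,
   is the one induced by the inner product. *)
HB.mixin Record isEuclidean (R : realType) E
    of Vector R E & NormedModule R E := {
  dotp : {dot E for idfun};
  normr_dotp : forall x : E, `|x| = Num.sqrt (dotp x x)
}.

#[short(type="euclideanType")]
HB.structure Definition Euclidean (R : realType) :=
  {E of isEuclidean R E & Vector R E & NormedModule R E}.

(* Any finite-dimensional space with an inner product is a euclideanType; an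
   alias is needed because V may already carry another norm, e.g. the sup norm
   when V is 'rV[R]_n. *)
Definition dot_space (R : realType) (V : vectType R) (d : {dot V for idfun})
  : Type := V.

Section dot_space.
Variables (R : realType) (V : vectType R) (d : {dot V for idfun}).

HB.instance Definition _ := Vector.on (dot_space d).

Lemma dot_space_ge0 (x : V) : 0 <= d x x.
Proof.
have [->|x0] := eqVneq x 0; first by rewrite linear0l.
exact/ltW/neq0_dnorm_gt0.
Qed.

Lemma dot_spaceC (x y : V) : d x y = d y x.
Proof. by rewrite hermC /= expr0 mul1r. Qed.

Lemma dot_spaceZZ (k l : R) (x y : V) : d (k *: x) (l *: y) = k * l * d x y.
Proof.
by rewrite linearZl_LR/= -[RHS]mulrA; congr (k * _); exact: linearZr_LR.
Qed.

Lemma dot_spaceDD (x y : V) : d (x + y) (x + y) = d x x + d x y *+ 2 + d y y.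
Proof. by rewrite linearDl !linearDr /= (dot_spaceC y x); ring. Qed.

Lemma dot_space_CauchySchwarz (x y : V) :
  d x y <= Num.sqrt (d x x) * Num.sqrt (d y y).
Proof.
rewrite -sqrtrM ?dot_space_ge0//.
apply: (@le_trans _ _ (Num.sqrt (d x y ^+ 2))).
  by rewrite sqrtr_sqr ler_norm.
apply: ler_wsqrtr.
have [->|y0] := eqVneq y 0; first by rewrite !linear0r expr2 !mulr0.
have yy : 0 < d y y by exact: neq0_dnorm_gt0.
have := dot_space_ge0 (d y y *: x + - d x y *: y).
rewrite dot_spaceDD !dot_spaceZZ => h.
have : 0 <= d y y * (d x x * d y y - d x y ^+ 2).
  by apply: le_trans h _; rewrite le_eqVlt; apply/orP; left; apply/eqP; ring.
by rewrite pmulr_rge0// subr_ge0.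
Qed.

Let norm (x : dot_space d) : R := Num.sqrt (d x x).

Let norm0 (x : dot_space d) : norm x = 0 -> x = 0.
Proof.
move=> /eqP; rewrite sqrtr_eq0 => h; apply/eqP; apply: contraTT h => x0.
by rewrite -ltNge; exact: neq0_dnorm_gt0.
Qed.

Let normZ (l : R) (x : dot_space d) : norm (l *: x) = `|l| * norm x.
Proof. by rewrite /norm (dot_spaceZZ l l x x) -expr2 sqrtrM ?sqr_ge0// sqrtr_sqr. Qed.

Let normD (x y : dot_space d) : norm (x + y) <= norm x + norm y.
Proof.
rewrite -[leRHS]ger0_norm; last by rewrite addr_ge0 ?sqrtr_ge0.
rewrite -sqrtr_sqr; apply: ler_wsqrtr.
rewrite (dot_spaceDD x y) sqrrD !sqr_sqrtr ?dot_space_ge0//.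
by rewrite lerD2r lerD2l lerMn2r /= dot_space_CauchySchwarz.
Qed.

HB.instance Definition _ :=
  @Lmodule_isNormed.Build R (dot_space d) norm normD normZ norm0.

HB.instance Definition _ :=
  @isEuclidean.Build R (dot_space d) d (fun=> erefl).

End dot_space.

Section convex_analysis.
Variables (R : realType) (E : euclideanType R).
Implicit Types (theta : E -> \bar R) (u : E).
Local Open Scope ereal_scope.

Definition edom theta : set E := [set u | theta u < +oo].

Definition proper theta := (forall u, -oo < theta u) /\ edom theta !=set0.

(* The right-hand side is never of the form +oo - oo for a proper function;
   the endpoints t = 0 and t = 1 are trivial. *)
Definition econvex theta := forall (t : R) u v, (0 < t < 1)%R ->
  theta (t *: u + (1 - t) *: v)%R <= t%:E * theta u + (1 - t)%:E * theta v.

(* For proper convex functions, closed means lower semicontinuous. *)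
Definition closed_proper_convex theta :=
  [/\ proper theta, econvex theta & lower_semicontinuous theta].

Definition recession_quotient theta u' u (rho : R) : \bar R :=
  (theta (u' + rho *: u)%R - theta u') * (rho^-1)%:E.

(* The base point is an arbitrary point of the effective domain; see
   recession_cvg below for the independence of that choice. *)
Definition recession theta u : \bar R :=
  lim (recession_quotient theta (xget 0%R (edom theta)) u rho
         @[rho --> +oo%R]).

Definition minimizers theta : set E :=
  [set u | forall v, theta u <= theta v].

Definition constancy_space theta : set E :=
  [set u | recession theta (- u)%R = - recession theta u /\
           - recession theta u = 0].

Section recession_independence.
Variables (theta : E -> \bar R) (hth : closed_proper_convex theta).

Let finE (v : E) : edom theta v -> exists a : R, theta v = a%:E.
Proof.
case: hth => -[ninf _] _ _; rewrite /edom /= => h.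
by exists (fine (theta v)); rewrite fineK// fin_numElt ninf h.
Qed.

Let quotient_ge (u' u : E) (r b a : R) : (0 < r)%R -> theta u' = a%:E ->
  (recession_quotient theta u' u r <= b%:E) =
  (theta (u' + r *: u)%R <= (a + r * b)%:E).
Proof.
move=> r0 ha'; rewrite /recession_quotient ha'; case: hth => -[ninf _] _ _.
have := ninf (u' + r *: u)%R; case: (theta _) => [t| |]// _.
  rewrite -EFinB -EFinM !lee_fin ler_pdivrMr// lerBlDl.
  by rewrite (mulrC b).
by rewrite addye// gt0_mulye ?lte_fin ?invr_gt0// !leye_eq.
Qed.

Let quotient_mono (u' u : E) (r s : R) : edom theta u' ->
  (0 < r)%R -> (r <= s)%R ->
  recession_quotient theta u' u r <= recession_quotient theta u' u s.
Proof.
move=> /finE[a ha] r0 rs; have s0 := lt_le_trans r0 rs.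
have [->//|rs'] := eqVneq r s.
have {}rs : (r < s)%R by rewrite lt_neqAle rs' rs.
case: hth => -[ninf _] cvx _.
have := ninf (u' + s *: u)%R.
case E1 : (theta (u' + s *: u)%R) => [b| |]// _; last first.
  rewrite [leRHS]/recession_quotient E1 ha addye// gt0_mulye ?leey//.
  by rewrite lte_fin invr_gt0.
rewrite [leRHS]/recession_quotient E1 ha -EFinB -EFinM (quotient_ge u _ r0 ha).
have rs01 : (0 < r / s < 1)%R by rewrite divr_gt0//= ltr_pdivrMr// mul1r.
have := cvx (r / s)%R (u' + s *: u)%R u' rs01.
rewrite E1 ha -!EFinM -EFinD.
have -> : (r / s *: (u' + s *: u) + (1 - r / s) *: u' = u' + r *: u)%R.
  rewrite scalerDr scalerA divfK ?gt_eqF// addrAC -scalerDl.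
  by rewrite [(r / s + _)%R]addrC subrK scale1r.
move=> /le_trans; apply; rewrite lee_fin le_eqVlt; apply/orP; left; apply/eqP.
by field; rewrite gt_eqF.
Qed.

Let ext (u' u : E) (r : R) : \bar R :=
  recession_quotient theta u' u (Num.max r 1)%R.

Let ext_cvg (u' u : E) : edom theta u' ->
  recession_quotient theta u' u r @[r --> +oo%R] -->
  ereal_sup (range (ext u' u)).
Proof.
move=> hu'.
have h : {homo ext u' u : r s / (r <= s)%R >-> r <= s}.
  move=> r s rs; apply: quotient_mono => //.
    by rewrite lt_max ltr01 orbT.
  by rewrite ge_max !le_max lexx rs orbT.
have := nondecreasing_cvge h; apply: cvg_trans.
apply: near_eq_cvg; near=> r; rewrite /ext max_l//.
Unshelve. all: by end_near. Qed.

Let ext_sup_le (u' u'' u : E) : edom theta u' -> edom theta u'' ->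
  ereal_sup (range (ext u'' u)) <= ereal_sup (range (ext u' u)).
Proof.
move=> /[dup] du' /finE[a' ha'] /finE[a'' ha''].
have r1P r : (1 <= Num.max r 1 :> R)%R by rewrite le_max lexx orbT.
have r0P r : (0 < Num.max r 1 :> R)%R by rewrite lt_max ltr01 orbT.
have ub s : (1 <= s)%R ->
    recession_quotient theta u' u s <= ereal_sup (range (ext u' u)).
  by move=> s1; apply: ereal_sup_ubound; exists s => //; rewrite /ext max_l.
case: hth => -[ninf _] cvx lsc.
case: (ereal_sup (range (ext u' u))) ub => [l| |] ub; last 2 first.
- by rewrite leey.
- have := ub 1%R (lexx _); rewrite leeNy_eq /recession_quotient ha' => /eqP.
  have := ninf (u' + 1 *: u)%R; case: (theta _) => [t| |]// _.
  by rewrite addye// gt0_mulye ?lte_fin ?invr_gt0.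
apply: ge_ereal_sup => _ [r0 _ <-]; rewrite /ext.
set r := Num.max r0 1%R; have r_gt0 : (0 < r)%R := r0P r0.
rewrite (quotient_ge u _ r_gt0 ha'') leNgt; apply/negP => hlt.
set w := (u'' + r *: u)%R in hlt *.
have [b bl bt] : exists2 b : R, (a'' + r * l < b)%R & b%:E < theta w.
  case: (theta w) hlt => [t| |]// h; last first.
    by exists (a'' + r * l + 1)%R; rewrite ?ltrDl ?ltry.
  by exists (((a'' + r * l) + t) / 2)%R; rewrite ?lte_fin ?midf_lt//.
have [V /nbhs_ballP[eps /= eps0 epsV] Vb] := lsc w b bt.
near (0%R : R)^'+ => e.
have e0 : (0 < e)%R by near: e; exact: nbhs_right_gt.
have e1 : (e < 1)%R by near: e; exact: nbhs_right_lt.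
have e2 : (e * (`|u' - u''| + 1) < eps)%R.
  rewrite -ltr_pdivlMr ?ltr_wpDl//; near: e; apply: nbhs_right_lt.
  by rewrite divr_gt0// ltr_wpDl.
have e3 : (e * (`|a' - a''| + 1) < b - (a'' + r * l))%R.
  rewrite -ltr_pdivlMr ?ltr_wpDl//; near: e; apply: nbhs_right_lt.
  by rewrite divr_gt0 ?subr_gt0// ltr_wpDl.
have re : (1 <= r / e)%R.
  by rewrite ler_pdivlMr// mul1r (le_trans (ltW e1))// r1P.
have re0 : (0 < r / e)%R := lt_le_trans ltr01 re.
have := ub _ re; rewrite (quotient_ge u _ re0 ha') => hu'.
have hV : V (e *: (u' + (r / e) *: u) + (1 - e) *: u'')%R.
  apply: epsV; rewrite -ball_normE /ball_ /=.
  have -> : (w - (e *: (u' + (r / e) *: u) + (1 - e) *: u'')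
             = - (e *: (u' - u'')))%R.
    rewrite /w scalerDr scalerA mulrC divfK ?gt_eqF// scalerBl scale1r scalerBr.
    rewrite opprB; apply/eqP; rewrite subr_eq !addrA subrK addrAC.
    by rewrite [(e *: u'' + r *: u)%R]addrC addrK addrC.
  rewrite normrN normrZ gtr0_norm//; apply: le_lt_trans e2.
  by rewrite ler_pM2l// lerDl.
have e01 : (0 < e < 1)%R by rewrite e0.
have := lt_le_trans (Vb _ hV) (cvx e (u' + (r / e) *: u)%R u'' e01).
rewrite ha'' ltNge => /negP; apply.
apply: (@le_trans _ _ (e%:E * (a' + r / e * l)%:E + (1 - e)%:E * a''%:E)).
  by rewrite leeD2r// lee_pmul2l ?lte_fin.
rewrite -!EFinM -EFinD lee_fin.
have -> : (e * (a' + r / e * l) + (1 - e) * a''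
           = a'' + r * l + e * (a' - a''))%R by field; rewrite gt_eqF.
rewrite -lerBrDl; apply: le_trans (ltW e3); rewrite ler_pM2l//.
by rewrite (le_trans (ler_norm _))// lerDl.
Unshelve. all: by end_near. Qed.

Lemma recession_cvg (u' u : E) : edom theta u' ->
  recession_quotient theta u' u rho @[rho --> +oo%R] --> recession theta u.
Proof.
move=> hu'; case: (hth) => -[_ nonempty] _ _.
have h0 : edom theta (xget 0%R (edom theta)).
  by case: xgetP => [x -> //|none]; case: nonempty => x /none.
rewrite /recession (cvg_lim _ (@ext_cvg _ u h0))//.
suff <- : ereal_sup (range (ext u' u)) =
  ereal_sup (range (ext (xget 0%R (edom theta)) u)) by exact: ext_cvg.
by apply/eqP; rewrite eq_le !ext_sup_le.
Qed.

End recession_independence.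

End convex_analysis.

Section operators.
Variable R : realType.

Definition adjoint_of (E F : euclideanType R) (A : E -> F) (Aadj : F -> E) :=
  forall u v, dotp (A u) v = dotp u (Aadj v).

Definition self_adjoint_psd (E : euclideanType R) (O : E -> E) :=
  adjoint_of O O /\ forall u, 0 <= dotp u (O u).

Definition op_seminorm (E : euclideanType R) (O : E -> E) (u : E) : R :=
  Num.sqrt (dotp u (O u)).

End operators.

Section augmented_lagrangian.
Variables (R : realType) (X Y Z : euclideanType R).
Variables (f : Y -> \bar R) (g : Z -> \bar R).
Variables (Aadj : Y -> X) (Badj : Z -> X) (c : X) (sigma : R).

Definition aug_lagrangian (y : Y) (z : Z) (x : X) : \bar R :=
  (f y + g z + (dotp x (Aadj y + Badj z - c)
                + sigma / 2 * `|Aadj y + Badj z - c| ^+ 2)%:E)%E.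

Definition objective_y (S : Y -> Y) (x' : X) (y' : Y) (z' : Z) (y : Y) :=
  (aug_lagrangian y z' x' + (2^-1 * op_seminorm S (y - y') ^+ 2)%:E)%E.

Definition objective_z (T : Z -> Z) (x' : X) (y' : Y) (z' : Z) (z : Z) :=
  (aug_lagrangian y' z x' + (2^-1 * op_seminorm T (z - z') ^+ 2)%:E)%E.

End augmented_lagrangian.

(* With (theta, K, O) = (f, A^*, S) and (g, B^*, T), the sets M and N. *)
Definition critical_directions (R : realType) (E X : euclideanType R)
    (theta : E -> \bar R) (K : E -> X) (O : E -> E) : set E :=
  [set u | K u = 0 /\ O u = 0] `\` constancy_space theta.

(* Main.v *)
(* Call u a recession direction of h when h never increases along the half-lines
   v + t u, t >= 0. If points x of a sublevel set of a closed proper convex h have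
   norms tending to infinity, every cluster point of x / |x| is a recession
   direction. Now suppose that the recession directions are closed under
   negation, and consider the points of least norm in sublevel sets below a fixed
   level. They stay bounded: if such an x is long and x / |x| is close to u, then
   x - |x| u is shorter and no higher. So h may be minimized over a closed ball.
   The objectives are sums theta + q with q a convex quadratic whose leading part
   vanishes at u exactly when K u = 0 and O u = 0 (K an adjoint operator, O the
   proximal one), and then q is constant along u; hence the recession directions
   of theta + q are the u in the two kernels with theta0+(u) <= 0. *)
Require Import Defs.
From mathcomp Require Import all_boot all_order all_algebra.
From mathcomp Require Import all_classical all_reals all_analysis.
From mathcomp Require Import finmap ring lra.

Set Implicit Arguments.
Unset Strict Implicit.
Unset Printing Implicit Defensive.

Import Order.TTheory GRing.Theory Num.Theory.
Import numFieldNormedType.Exports.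

Local Open Scope classical_set_scope.
Local Open Scope ring_scope.

(** * Compactness, continuity and minimization in finite dimension *)

Section topology.
Variable R : realType.

Lemma continuous_linear_rV n (F : normedModType R)
  (L : {linear 'rV[R]_n -> F}) : continuous L.
Proof.
have -> : L = (fun w => \sum_i w 0 i *: L 'e_i) :> (_ -> F).
  apply/funext => w; rewrite {1}[w]row_sum_delta linear_sum.
  by apply: eq_bigr => i _; rewrite linearZ.
apply: continuous_big => [|i _ w]; first exact: add_continuous.
apply: cvgZr_tmp; [exact: nbhs_filter|exact: coord_continuous].
Qed.

Lemma closed_norm_le (E : normedModType R) (M : R) :
  closed [set x : E | `|x| <= M].
Proof.
apply: (@preimage_closed _ _ (fun x : E => `|x|) [set r | r <= M]).
  by move=> x _; exact: norm_continuous.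
exact: closed_le.
Qed.

Import VectorInternalTheory.

Section finite_dimension.
Variable E : euclideanType R.

(* The norm of E is bounded below on the coordinate unit sphere, which is compact. *)
Lemma v2r_bounded : exists C : R, forall x : E, `|v2r x| <= C * `|x|.
Proof.
pose U := [set w : 'rV[R]_(dim E) | `|w| = 1].
have Uc : compact U.
  apply: bounded_closed_compact.
    by exists 1; split; [exact: num_real|move=> r r1 w /= ->; exact: ltW].
  apply: (@preimage_closed _ _ (fun x : 'rV[R]_(dim E) => `|x|) [set r | r = 1]).
    by move=> x _; exact: norm_continuous.
  exact: closed_eq.
pose N (w : 'rV[R]_(dim E)) : R := `|r2v w : E|.
have Nc : continuous N.
  move=> w; apply: continuous_comp; last exact: norm_continuous.
  exact: continuous_linear_rV.
(* In dimension 0 the coordinate sphere is empty; every coordinate vector is then 0 and the constant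
   0 serves. *)
have [U0|U0] := pselect (U !=set0); last first.
  exists 0 => x; have [->|x0] := eqVneq (v2r x) 0.
    by rewrite normr0 mul0r.
  case: U0; exists (`|v2r x|^-1 *: v2r x).
  by rewrite /U /= normrZ normfV normr_id mulVf// normr_eq0.
have [w0 /set_mem w0U hw0] := compact_EVT_min U0 Uc (continuous_subspaceT Nc).
have N0 : 0 < N w0.
  rewrite normr_gt0; apply/eqP => h; move: w0U.
  have -> : w0 = 0 by rewrite -(r2vK w0) h linear0.
  by rewrite /U /= normr0 => /esym/eqP; rewrite oner_eq0.
exists (N w0)^-1 => x; have [->|x0] := eqVneq (v2r x) 0.
  by rewrite normr0 mulr_ge0// invr_ge0 ltW.
have nx : 0 < `|v2r x| by rewrite normr_gt0.
have xU : `|v2r x|^-1 *: v2r x \in U.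
  by apply/mem_set; rewrite /U /= normrZ normfV normr_id mulVf// gt_eqF.
have := hw0 _ xU.
rewrite /N linearZ /= v2rK normrZ normfV normr_id.
by rewrite ler_pdivlMl// ler_pdivlMl// mulrC.
Qed.

(** The ball is the image under [r2v] of a set of coordinate vectors that is closed, and bounded by
    [v2r_bounded]. *)
Lemma closed_ball_compact (M : R) : compact [set x : E | `|x| <= M].
Proof.
have [C hC] := v2r_bounded.
pose B := [set w : 'rV[R]_(dim E) | `|r2v w : E| <= M].
have -> : [set x : E | `|x| <= M] = r2v @` B.
  apply/seteqP; split => [x xM|_ [w wB <-]//].
  by exists (v2r x); rewrite ?v2rK// /B /= v2rK.
apply: continuous_compact; first by apply: continuous_subspaceT; exact: continuous_linear_rV.
apply: bounded_closed_compact.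
  exists (`|C| * M); split; [exact: num_real|move=> r rM w /= wB; apply: le_trans (ltW rM)].
  rewrite -[w]r2vK; apply: le_trans (hC _) _.
  by apply: le_trans (ler_wpM2r _ (ler_norm C)) _ => //; exact: ler_wpM2l.
apply: (@preimage_closed _ _ (@r2v _ E) [set x | `|x| <= M]).
  by move=> w _; exact: continuous_linear_rV.
exact: closed_norm_le.
Qed.

(** Factor [L] through coordinates: [v2r] is continuous because it is bounded, and [L \o r2v] is
    linear on row vectors. *)
Lemma continuous_linear (F : normedModType R) (L : {linear E -> F}) :
  continuous L.
Proof.
have [C hC] := v2r_bounded.
have vc : continuous (@v2r _ E).
  apply: bounded_linear_continuous; apply/linear_boundedP.
  near=> r => x; apply: le_trans (hC x) _; apply: ler_wpM2r => //.
have -> : L = (fun x => (L \o r2v) (v2r x)) :> (_ -> F).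
  by apply/funext => x /=; rewrite v2rK.
move=> x; apply: (@continuous_comp _ _ _ (@v2r _ E) (L \o r2v)); first exact: vc.
exact: continuous_linear_rV.
Unshelve. all: by end_near. Qed.

End finite_dimension.

(** Without a minimizer, the open sets where [phi] exceeds [phi v], for [v] in [K], cover [K]. Among
    the indices of a finite subcover, one with the smallest value is left uncovered. *)
Lemma lsc_compact_min (T : ptopologicalType) (K : set T) (phi : T -> \bar R) :
  K !=set0 -> compact K -> lower_semicontinuous phi ->
  (forall x, -oo < phi x)%E ->
  exists2 m, K m & forall v, K v -> (phi m <= phi v)%E.
Proof.
move=> [k Kk] + lsc ninf; rewrite compact_cover => cK.
apply: contrapT => nomin.
have Uo v : K v -> open [set x | (phi v < phi x)%E].
  move=> _; have := ninf v; case: (phi v) => [a| |]// _.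
    by have /lower_semicontinuousP := lsc; apply.
  rewrite (_ : mkset _ = set0); first exact: open0.
  by apply/seteqP; split => x //=; rewrite ltNge leey.
have Kcov : K `<=` cover K (fun v => [set x | (phi v < phi x)%E]).
  move=> x Kx; apply: contrapT => h; apply: nomin; exists x => // v Kv.
  by rewrite leNgt; apply/negP => vx; apply: h; exists v.
have [D DK Dcov] := cK _ _ _ Uo Kcov.
have [m mD hm] : exists2 m, m \in D & forall v, v \in D -> (phi m <= phi v)%E.
  have [v /= vD _] := Dcov _ Kk.
  have [m _ hm] := @arg_minP _ _ _ [` vD]%fset xpredT (fun v : D => phi (val v)) isT.
  exists (val m); first exact: valP.
  by move=> w wD; exact: (hm [` wD]%fset).
have [v /= vD] := Dcov _ (set_mem (DK _ mD)).
by rewrite ltNge hm.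
Qed.

End topology.

(** * Recession directions, existence and boundedness of minimizers *)

Section recession_directions.
Variables (R : realType) (E : euclideanType R).
Implicit Types (h : E -> \bar R) (u v : E).

Definition recession_direction h u :=
  forall v t, 0 <= t -> (h (v + t *: u)%R <= h v)%E.

(** The unit sphere is compact, so the normalizations of points of [Q] with norms tending to
    infinity have a cluster point [u]. *)
Lemma unbounded_direction (Q : set E) : ~ bounded_set Q ->
  exists2 u : E, `|u| = 1 & forall N e, 0 < e ->
    exists x, [/\ Q x, N < `|x| & `|u - `|x|^-1 *: x| < e].
Proof.
move=> unbQ.
have /choice[x hx] (n : nat) : exists x, Q x /\ n%:R < `|x|.
  apply: contrapT => nx; apply: unbQ.
  exists n%:R; split; first exact: num_real.
  move=> r nr x Qx /=; rewrite leNgt; apply/negP => rx; apply: nx; exists x.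
  by split=> //; exact: lt_trans rx.
pose y n := `|x n|^-1 *: x n.
have x0 n : 0 < `|x n| by apply: le_lt_trans (hx n).2.
have y1 n : `|y n| = 1 by rewrite normrZ normfV normr_id mulVf// gt_eqF.
have cS : compact [set w : E | `|w| = 1].
  apply: subclosed_compact _ (@closed_ball_compact R E 1) _.
    apply: (@preimage_closed _ _ (fun w : E => `|w|) [set r | r = 1]).
      by move=> w _; exact: norm_continuous.
    exact: closed_eq.
  by move=> w /= ->.
have [|u [u1 clu]] := cS (y @ \oo) _.
  by exists 0%N => // n _ /=; exact: y1.
exists u => // N e e0.
(* Using the image of a tail of indices ensures that the point found close to [u] has an index
   beyond [N]. *)
have yN : \forall n \near \oo, (y @` [set n | N < n%:R]) (y n).
  near=> n; exists n => //=; near: n; exact: nbhs_infty_gtr.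
have [_ [[n /= Nn <-] une]] := clu _ _ yN (nbhsx_ballx u _ e0).
exists (x n); split; [exact: (hx n).1|exact: lt_trans Nn (hx n).2|].
by move: une; rewrite -ball_normE.
Unshelve. all: by end_near. Qed.

Section closed_convex.
Variable h : E -> \bar R.
Hypothesis hh : closed_proper_convex h.

(* [v + t u] is the limit of points [v + (t / |x|) (x - v)] of the segments
   from [v] to [x], where convexity bounds [h]. *)
Lemma sublevel_direction (a : R) (u : E) :
  (forall N e, 0 < e -> exists x, [/\ (h x <= a%:E)%E, N < `|x| &
     `|u - `|x|^-1 *: x| < e]) ->
  recession_direction h u.
Proof.
case: hh => -[ninf _] cvx lsc hu v t; rewrite le_eqVlt => /predU1P[<-|t0].
  by rewrite scale0r addr0.
have := ninf v; case hv : (h v) => [b| |]// _; last by rewrite leey.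
rewrite leNgt; apply/negP => hlt.
have [b' bb' hb'] : exists2 b' : R, (b < b') & (b'%:E < h (v + t *: u)%R)%E.
  case: (h (v + t *: u)%R) hlt => [s| |]// hs; last first.
    by exists (b + 1)%R; rewrite ?ltrDl ?ltry.
  by exists ((b + s) / 2)%R; rewrite ?lte_fin ?midf_lt//.
have [V /nbhs_ballP[eps /= eps0 epsV] Vb] := lsc _ _ hb'.
have e0 : 0 < eps / (2 * t) by rewrite divr_gt0// mulr_gt0.
(* The three summands ensure in turn that t / |x| < 1, that (t / |x|) v has norm at most eps / 2,
   and that the convexity bound is at most [b']. The tolerance [eps / (2 * t)] leaves the other eps
   / 2 for t (u - x / |x|). *)
have [x [hx Nx ux]] :=
  hu (t + t * `|v| * 2 / eps + t * `|a - b| / (b' - b)) _ e0.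
have p1 : 0 <= t * `|v| * 2 / eps.
  by rewrite divr_ge0 ?(ltW eps0)// !mulr_ge0// ltW.
have p2 : 0 <= t * `|a - b| / (b' - b).
  by rewrite divr_ge0 ?subr_ge0 ?(ltW bb')// mulr_ge0// ltW.
have tx : t < `|x| by lra.
have x0 : 0 < `|x| by lra.
have l01 : 0 < t / `|x| < 1 by rewrite divr_gt0//= ltr_pdivrMr// mul1r.
have /andP[l0 l1] := l01.
have hV : V (t / `|x| *: x + (1 - t / `|x|) *: v).
  apply: epsV; rewrite -ball_normE /ball_ /=.
  have -> : v + t *: u - (t / `|x| *: x + (1 - t / `|x|) *: v) =
      t *: (u - `|x|^-1 *: x) + (t / `|x|) *: v.
    rewrite scalerBr scalerA scalerBl scale1r opprD opprB.
    by rewrite -!addrA addrC !addrA subrK.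
  apply: le_lt_trans (ler_normD _ _) _; rewrite (normrZ t) (normrZ (t / _)) (gtr0_norm t0) (gtr0_norm l0).
  have h1 : t * `|u - `|x|^-1 *: x| < eps / 2.
    rewrite -ltr_pdivlMl//; apply: lt_le_trans ux _.
    by rewrite le_eqVlt; apply/orP; left; apply/eqP; field; rewrite gt_eqF.
  have h2 : t / `|x| * `|v| <= eps / 2.
    rewrite mulrAC ler_pdivrMr// -ler_pdivrMl ?divr_gt0//.
    have -> : (eps / 2)^-1 * (t * `|v|) = t * `|v| * 2 / eps.
      by field; rewrite gt_eqF.
    lra.
  by rewrite [ltRHS]splitr; exact: ltr_leD.
have := lt_le_trans (Vb _ hV) (cvx _ x v l01).
rewrite ltNge hv => /negP; apply.
apply: (@le_trans _ _ ((t / `|x|)%:E * a%:E + (1 - t / `|x|)%:E * b%:E)%E).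
  by rewrite leeD2r// lee_pmul2l ?lte_fin.
rewrite -!EFinM -EFinD lee_fin.
have -> : t / `|x| * a + (1 - t / `|x|) * b = b + t * (a - b) / `|x|.
  by field; rewrite gt_eqF.
rewrite -lerBrDl ler_pdivrMr//.
apply: (@le_trans _ _ (t * `|a - b|)); first by rewrite ler_pM2l// ler_norm.
rewrite -ler_pdivrMl ?subr_gt0// mulrC; lra.
Qed.

Lemma minimizer_exists :
  (forall u, recession_direction h u -> recession_direction h (- u)) ->
  minimizers h !=set0.
Proof.
case: (hh) => -[ninf [v0 v0dom]] cvx lsc sym.
have [a ha] : exists a : R, h v0 = a%:E.
  by exists (fine (h v0)); rewrite fineK// fin_numElt ninf.
(* Each point of [Q] has least norm in its own sublevel set, whose level varies below [a]. *)
pose Q := [set x | (h x <= a%:E)%E /\ forall z, (h z <= h x)%E -> `|x| <= `|z|].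
have bQ : bounded_set Q.
  apply: contrapT => /unbounded_direction[u u1 hu].
  have du : recession_direction h u.
    apply: (@sublevel_direction a) => N e e0.
    by have [x [[hx _] Nx ux]] := hu N e e0; exists x.
  have [x [[hx hmin] x0 ux]] := hu 0 1 ltr01.
  have := hmin (x + `|x| *: - u) (sym _ du _ _ (ltW x0)).
  rewrite leNgt => /negP; apply.
  have -> : x + `|x| *: - u = - (`|x| *: (u - `|x|^-1 *: x)).
    by rewrite scalerBr scalerA divff ?gt_eqF// scale1r opprB scalerN.
  by rewrite normrN normrZ normr_id -[ltRHS]mulr1 ltr_pM2l.
(* Minimize the norm over the sublevel set of [v] cut by the ball of radius |v|. Points outside that
   ball are longer than [v], so the cut loses no competitor. *)
have Qle v : (h v <= a%:E)%E -> exists2 z, Q z & (h z <= h v)%E.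
  move=> hv.
  have hvfin : h v \is a fin_num.
    by rewrite fin_numElt ninf; apply: le_lt_trans hv _; exact: ltry.
  pose K := [set x | (h x <= h v)%E] `&` [set x | `|x| <= `|v| ].
  have cK : compact K.
    apply: subclosed_compact _ (@closed_ball_compact R E `|v|) _; last first.
      by move=> x [].
    apply: closedI; last exact: closed_norm_le.
    rewrite (_ : mkset _ = ~` [set x | (h v < h x)%E]); last first.
      by apply/seteqP; split=> x /=; rewrite leNgt => /negP.
    apply: open_closedC; rewrite -(fineK hvfin).
    by have /lower_semicontinuousP := lsc; apply.
  have K0 : K !=set0 by exists v; split => /=.
  have [m /set_mem[hm mv] mmin] := compact_EVT_min K0 cK
    (continuous_subspaceT (@norm_continuous _ E)).
  exists m => //; split; first exact: le_trans hv.
  move=> z hz; have [zv|/ltW vz] := leP `|z| `|v|; last exact: le_trans vz.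
  by apply: mmin; apply/mem_set; split=> //; exact: le_trans hm.
have [M QM] : exists M, forall x, Q x -> `|x| <= M.
  by have [M [_ hM]] := bQ; exists (M + 1) => x; apply: hM; rewrite ltrDl.
have [z0 z0Q hz0] : exists2 z, Q z & (h z <= a%:E)%E.
  by rewrite -ha; apply: Qle; rewrite ha.
(* A minimum over the ball containing [Q] is global: points at level at most [a] are dominated by
   points of [Q], and the others by [z0]. *)
have [m _ hm] : exists2 m, `|m| <= M & forall v, `|v| <= M -> (h m <= h v)%E.
  apply: lsc_compact_min lsc ninf; last exact: (@closed_ball_compact R E).
  by exists z0; exact: QM.
exists m => v; have [hv|/ltW hv] := leP (h v) a%:E.
  by have [z Qz hz] := Qle _ hv; apply: le_trans hz; apply: hm; exact: QM.
by apply: le_trans hv; apply: le_trans hz0; apply: hm; exact: QM.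
Qed.

(** Minimizers lie in one sublevel set, so an unbounded family of them would yield a recession
    direction of norm 1. Conversely, a half-line from a minimizer along a recession direction
    consists of minimizers. *)
Lemma minimizers_boundedP :
  (forall u, recession_direction h u -> u = 0) <->
  minimizers h !=set0 /\ bounded_set (minimizers h).
Proof.
case: (hh) => -[ninf [v0 v0dom]] cvx lsc; split=> [h0|[[m mmin] bd] u du].
  split; first by apply: minimizer_exists => u du; rewrite (h0 _ du) oppr0 -(h0 _ du).
  have [a ha] : exists a : R, h v0 = a%:E.
    by exists (fine (h v0)); rewrite fineK// fin_numElt ninf.
  apply: contrapT => /unbounded_direction[u u1 hu].
  have /h0 u0 : recession_direction h u.
    apply: (@sublevel_direction a) => N e e0.
    by have [x [hx Nx ux]] := hu N e e0; exists x; split=> //; rewrite -ha.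
  by move/eqP: u1; rewrite u0 normr0 eq_sym oner_eq0.
apply: contrapT => /eqP u0.
have {}u0 : 0 < `|u| by rewrite normr_gt0.
have [M [_ hM]] := bd.
(* With this [t], |m + t u| is at least |M| + 2, beyond the bound |M| + 1 on minimizers. *)
pose t := (`|M| + 1 + `|m| + 1) / `|u|.
have t0 : 0 <= t by rewrite divr_ge0// !addr_ge0.
have := hM (`|M| + 1) _ (m + t *: u) _.
have := ler_norm M => MM /(_ ltac:(lra)) /=.
have tm : forall v, (h (m + t *: u)%R <= h v)%E.
  by move=> v; apply: le_trans (mmin v); exact: du.
move=> /(_ tm).
have := ler_normB (m + t *: u) m; rewrite addrAC subrr add0r normrZ.
rewrite ger0_norm// /t divfK ?gt_eqF// => ? ?; lra.
Qed.

End closed_convex.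
End recession_directions.

(** * Recession directions and the sign of the recession function *)

Section recession_sign.
Variables (R : realType) (E : euclideanType R) (theta : E -> \bar R).
Hypothesis hth : closed_proper_convex theta.
Local Open Scope ereal_scope.

Lemma edom_fin v : edom theta v -> exists a : R, theta v = a%:E.
Proof.
case: hth => -[ninf _] _ _ dv; exists (fine (theta v)).
by rewrite fineK// fin_numElt ninf.
Qed.

(** By convexity, a value at [s] below the line of slope [b] would force the value at [t] below it
    too. The product form avoids quotients of infinite values. *)
Lemma slope_nondecreasing v u (a b t s : R) : theta v = a%:E ->
  (0 < t <= s)%R -> (a + t * b)%:E <= theta (v + t *: u)%R ->
  (a + s * b)%:E <= theta (v + s *: u)%R.
Proof.
move=> va /andP[t0]; rewrite le_eqVlt => /predU1P[<-//|ts] tb.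
have s0 : (0 < s)%R := lt_trans t0 ts.
case: hth => -[ninf _] cvx _.
rewrite leNgt; apply/negP => hs; move: tb; apply/negP; rewrite -ltNge.
have := ninf (v + s *: u)%R.
case hc : (theta (v + s *: u)%R) hs => [c| |]//; rewrite lte_fin => cs _.
have ts01 : (0 < t / s < 1)%R by rewrite divr_gt0//= ltr_pdivrMr// mul1r.
have := cvx (t / s)%R (v + s *: u)%R v ts01.
rewrite hc va -!EFinM -EFinD.
have -> : (t / s *: (v + s *: u) + (1 - t / s) *: v = v + t *: u)%R.
  by rewrite scalerDr scalerA divfK ?gt_eqF// addrAC -scalerDl [(t / s + _)%R]addrC subrK scale1r.
move=> /le_lt_trans; apply; rewrite lte_fin.
have -> : (t / s * c + (1 - t / s) * a = a + t * ((c - a) / s))%R.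
  by field; rewrite gt_eqF.
by rewrite ltrD2l ltr_pM2l// ltr_pdivrMr// ltrBlDl mulrC.
Qed.

(** An increase from any [v] gives a positive slope, which persists farther out and bounds the limit
    from below. The limit may be taken at this [v] since [recession] is independent of the base
    point. *)
Lemma recession_le0P u :
  recession theta u <= 0 <-> recession_direction theta u.
Proof.
case: (hth) => -[ninf [v0 v0dom]] cvx _; split=> [rec v t|du].
  rewrite le_eqVlt => /predU1P[<-|t0]; first by rewrite scale0r addr0.
  have [->|] := eqVneq (theta v) +oo; first exact: leey.
  rewrite -ltey => vdom; have [a va] := edom_fin vdom.
  rewrite va leNgt; apply/negP => hlt.
  (* The slope reached at [t], or 1 if the value there is infinite. *)
  have [b b0 hb] : exists2 b : R, (0 < b)%R & (a + t * b)%:E <= theta (v + t *: u)%R.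
    case: (theta _) hlt => [c| |]// => [ac|_]; last by exists 1%R; rewrite ?leey.
    exists ((c - a) / t)%R; first by rewrite divr_gt0// subr_gt0.
    by rewrite mulrC divfK ?gt_eqF// addrC subrK.
  have : b%:E <= recession theta u.
    apply: (cvge_to_ge (recession_cvg hth vdom)).
    near=> s.
    have ts : (t <= s)%R by near: s; apply: nbhs_pinfty_ge; exact: num_real.
    have s0 : (0 < s)%R := lt_le_trans t0 ts.
    have tts : (0 < t <= s)%R by rewrite t0.
    have := slope_nondecreasing va tts hb.
    rewrite /recession_quotient va; case: (theta _) => [c| |]//.
      by rewrite -EFinB -EFinM !lee_fin ler_pdivlMr// lerBrDl mulrC.
    by move=> _; rewrite addye// gt0_mulye ?lte_fin ?invr_gt0// leey.
  by move=> /le_trans/(_ rec); rewrite lee_fin leNgt b0.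
apply: (cvge_to_le (recession_cvg hth v0dom)); near=> s.
have s0 : (0 < s)%R by near: s; apply: nbhs_pinfty_gt; exact: num_real.
have [a va] := edom_fin v0dom.
have := du v0 s (ltW s0); have := ninf (v0 + s *: u)%R.
rewrite /recession_quotient va; case: (theta _) => [c| |]// _.
by rewrite -EFinB -EFinM !lee_fin ler_pdivrMr// mul0r subr_le0.
Unshelve. all: by end_near. Qed.

End recession_sign.

(** * Adding a convex quadratic *)

Section quadratic_perturbation.
Variables (R : realType) (E : euclideanType R) (theta : E -> \bar R).
(** [l v u] stands for the derivative of [q] at [v] along [u], and [a u] for half its second
    derivative along [u]. *)
Variables (q : E -> R) (l : E -> E -> R) (a : E -> R).
Hypothesis hth : closed_proper_convex theta.
Hypothesis q_continuous : continuous q.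
Hypothesis qE : forall v u t, q (v + t *: u) = q v + t * l v u + t ^+ 2 * a u.
Hypothesis a_ge0 : forall u, 0 <= a u.
Hypothesis l_eq0 : forall v u, a u = 0 -> l v u = 0.
Local Open Scope ereal_scope.

Let h v := theta v + (q v)%:E.

(** The convexity gap of [q] between [u] and [v] is t (1 - t) a(u - v). For semicontinuity, a level
    [b] is split into [c] for [theta] and [b - c] for [q], each strictly below the value at [v]. *)
Lemma quadratic_perturbation_closed_proper_convex : closed_proper_convex h.
Proof.
case: hth => -[ninf [v0 v0dom]] cvx lsc; split.
- split; first by move=> v; rewrite /h; case: (theta v) (ninf v) => [x _|_|//]; rewrite ?addye// -EFinD ltNyr.
  by exists v0; rewrite /edom /h /=; apply: lte_add_pinfty => //; exact: ltry.
- move=> t u v t01; case/andP: (t01) => t0 t1.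
  have t1' : (0 < 1 - t)%R by rewrite subr_gt0.
  have qc : (q (t *: u + (1 - t) *: v) <= t * q u + (1 - t) * q v)%R.
    have -> : (t *: u + (1 - t) *: v = v + t *: (u - v))%R.
      by rewrite scalerBl scale1r scalerBr addrCA addrC -addrA [(- _ + _)%R]addrC addrA.
    have -> : (q u = q (v + 1 *: (u - v)))%R by rewrite scale1r addrC subrK.
    rewrite !qE; have := a_ge0 (u - v)%R; set A := a _; set L := l _ _ => A0.
    have := mulr_ge0 (mulr_ge0 (ltW t0) (ltW t1')) A0; lra.
  have := cvx t u v t01; rewrite /h.
  case: (theta u) (ninf u) => [x| |]// _; last first.
    move=> _; rewrite addye// gt0_muley ?lte_fin// addye ?leey//.
    by case: (theta v) (ninf v) => [y| |]// _; rewrite addye// gt0_muley ?lte_fin.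
  case: (theta v) (ninf v) => [y| |]// _; last first.
    by move=> _; rewrite addye// gt0_muley ?lte_fin// addey ?leey.
  rewrite -!EFinD.
  case: (theta _) (ninf (t *: u + (1 - t) *: v)%R) => [w| |]// _.
  rewrite -EFinD !lee_fin; lra.
- move=> v b; rewrite /h => hb.
  have [c cv bc] : exists2 c : R, c%:E < theta v & (b - q v < c)%R.
    case: (theta v) hb (ninf v) => [x| |]//; last first.
      by move=> _ _; exists (b - q v + 1)%R; rewrite ?ltry// ltrDl.
    rewrite -EFinD lte_fin => bx _; exists ((b - q v + x) / 2)%R.
      by rewrite lte_fin midf_lt// ltrBlDr.
    by rewrite midf_lt// ltrBlDr.
  have [V nV Vc] := lsc _ _ cv.
  exists (V `&` [set w | (b - c < q w)%R]).
    have bcq : (b - c < q v)%R by lra.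
    apply: filterI => //; exact: (cvgr_gt _ (@q_continuous v) _ bcq).
  move=> w [/Vc cw /= bw]; case: (theta w) cw => [x| |]//; last by rewrite addye ?ltry.
  by rewrite -EFinD !lte_fin; lra.
Qed.

(* A convex function decreases at most linearly along a half-line, so the
   quadratic part of [q] has to vanish in a recession direction of [h]. *)
Lemma quadratic_perturbation_recession u :
  recession_direction h u <-> a u = 0%R /\ recession_direction theta u.
Proof.
have q_const v t : a u = 0%R -> q (v + t *: u)%R = q v.
  by move=> au; rewrite qE au l_eq0// !mulr0 !addr0.
case: (hth) => -[ninf [v0 v0dom]] cvx lsc; split=> [du|[au du] v t t0]; last first.
  by rewrite /h q_const// leeD2r// du.
suff au : a u = 0%R.
  split=> // v t t0; have := du v t t0; rewrite /h q_const//.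
  by rewrite leeD2rE.
apply: contrapT => /eqP au.
have {}au : (0 < a u)%R by rewrite lt_neqAle eq_sym au a_ge0.
have [x v0x] := edom_fin hth v0dom.
have [y hy] : exists y : R, (x + 1 * y)%:E <= theta (v0 + 1 *: u)%R.
  have := ninf (v0 + 1 *: u)%R; case: (theta _) => [y| |]// _; last by exists 0%R; rewrite leey.
  by exists (y - x)%R; rewrite mul1r addrC subrK.
(* Here [y] bounds the slope of [theta] from below at every step at least 1. This [s] makes
   [l v0 u + y + s * a u] at least [a u], while [du] makes it nonpositive. *)
pose s : R := (1 + `|l v0 u + y| / a u)%R.
have s1 : (1 <= s)%R by rewrite lerDl divr_ge0// ltW.
have s01 : (0 < (1 : R) <= s)%R by apply/andP; split.
have := slope_nondecreasing hth v0x s01 hy.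
have := du v0 s (le_trans ler01 s1); rewrite /h v0x.
case: (theta _) => [z| |]//; rewrite -!EFinD !lee_fin qE.
have sa : (s * a u = a u + `|l v0 u + y|)%R.
  by rewrite /s mulrDl mul1r divfK// gt_eqF.
have := ler_norm (- (l v0 u + y))%R; rewrite normrN.
move: sa; set N := `|_|%R; set A := a u in au *; set L := l _ _ => sa N0 h1 h2.
have : (s * (L + y + s * A) <= 0)%R by lra.
by rewrite pmulr_rle0 ?(lt_le_trans ltr01)// sa; lra.
Qed.

End quadratic_perturbation.

(** * Inner products and positive semidefinite forms *)

Section dotp_theory.
Variables (R : realType) (E : euclideanType R).
Implicit Types u v w : E.

Lemma dotpC u v : dotp u v = dotp v u. Proof. exact: dot_spaceC. Qed.

Lemma dotpDr u v w : dotp u (v + w) = dotp u v + dotp u w.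
Proof. exact: linearDr. Qed.

Lemma dotpZr u v (t : R) : dotp u (t *: v) = t * dotp u v.
Proof. exact: linearZr_LR. Qed.

Lemma dotpDl u v w : dotp (u + v) w = dotp u w + dotp v w.
Proof. by rewrite dotpC dotpDr !(dotpC w). Qed.

Lemma dotpZl u v (t : R) : dotp (t *: u) v = t * dotp u v.
Proof. by rewrite dotpC dotpZr dotpC. Qed.

Lemma dotp0r u : dotp u 0 = 0. Proof. exact: linear0r. Qed.

Lemma dotpp u : dotp u u = `|u| ^+ 2.
Proof. by rewrite normr_dotp sqr_sqrtr// dot_space_ge0. Qed.

(** Reduces continuity of the inner product to continuity of the norm. *)
Lemma dotp_polarization u v :
  dotp u v = (`|u + v| ^+ 2 - `|u - v| ^+ 2) / 4.
Proof.
rewrite -!dotpp -(scaleN1r v) !(dotpDl, dotpDr, dotpZl, dotpZr) (dotpC v u).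
by field.
Qed.

Lemma continuous_dotp (T : topologicalType) (f g : T -> E) :
  continuous f -> continuous g -> continuous (fun s => dotp (f s) (g s)).
Proof.
move=> fc gc.
have -> : (fun s => dotp (f s) (g s)) =
    fun s => (`|f s + g s| ^+ 2 - `|f s - g s| ^+ 2) / 4.
  by apply/funext => s; exact: dotp_polarization.
move=> s; apply: cvgM; last exact: cvg_cst.
have sqc (w : T -> E) : continuous w -> continuous (fun s => `|w s| ^+ 2).
  move=> wc r; rewrite (_ : (fun _ => _) = fun s => `|w s| * `|w s|)//.
  by apply: cvgM; apply: cvg_norm; exact: wc.
by apply: cvgB; apply: sqc => r; [apply: cvgD|apply: cvgB];
  (exact: fc || exact: gc).
Qed.

(** At u + s O u the form equals 2 s |O u|^2 + s^2 r, which is negative for small negative [s]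
    unless [O u] vanishes. *)
Lemma psd_form_eq0 (O : {linear E -> E}) u :
  self_adjoint_psd O -> dotp u (O u) = 0 -> O u = 0.
Proof.
move=> [Osym Opos] u0.
set p := `|O u| ^+ 2; set r := dotp (O u) (O (O u)).
have r0 : 0 <= r by exact: Opos.
have p0 : 0 <= p by exact: sqr_ge0.
(* The added 1 keeps the denominator positive when [r] is 0. *)
pose s := - (p / (r + 1)).
have := Opos (u + s *: O u).
rewrite linearD linearZ /= !(dotpDl, dotpDr, dotpZl, dotpZr).
rewrite -(Osym u (O u)) u0 dotpp -/p -/r => h.
have : 0 <= p ^+ 2 / (r + 1) * (r / (r + 1) - 2).
  by apply: le_trans h _; rewrite le_eqVlt; apply/orP; left; apply/eqP; rewrite /s; field; lra.
have r2 : r / (r + 1) - 2 < 0.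
  by rewrite subr_lt0 ltr_pdivrMr; lra.
rewrite nmulr_lge0// pmulr_lle0 ?invr_gt0; last by lra.
move=> h2; have : p ^+ 2 == 0 by rewrite eq_le h2 sqr_ge0.
by rewrite !expf_eq0 /= normr_eq0 => /eqP.
Qed.

End dotp_theory.

(** * The common form of the two objectives *)

Section augmented_objective.
Variables (R : realType) (E X : euclideanType R) (theta : E -> \bar R).
Variables (K : {linear E -> X}) (O : {linear E -> E}).
Variables (sigma k : R) (x e : X) (u0 : E).
Hypothesis hth : closed_proper_convex theta.
Hypothesis sigma0 : 0 < sigma.
Hypothesis hO : self_adjoint_psd O.

(** [k] is the value of the other function at its fixed point, [e] the fixed part of the constraint
    residual, and [u0] the proximal centre. *)
Let q v := k + dotp x (K v + e) + sigma / 2 * `|K v + e| ^+ 2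
           + 2^-1 * dotp (v - u0) (O (v - u0)).

Let l v u := dotp x (K u) + sigma * dotp (K u) (K v + e) + dotp u (O (v - u0)).

Let a u := sigma / 2 * `|K u| ^+ 2 + 2^-1 * dotp u (O u).

Let qE v u t : q (v + t *: u) = q v + t * l v u + t ^+ 2 * a u.
Proof.
rewrite /q /l /a [v + t *: u - u0]addrAC (linearD K) (linearZ_LR K) /= [K v + _ + e]addrAC.
move: (v - u0) (K v + e) => w z.
rewrite (linearD O) (linearZ_LR O) /= -!dotpp !(dotpDl, dotpDr, dotpZl, dotpZr).
rewrite (dotpC z (K u)) -(hO.1 w u) (dotpC (O w) u); by field.
Qed.

Let q_continuous : continuous q.
Proof.
have Kec : continuous (fun v => K v + e).
  by move=> v; apply: cvgD; [exact: continuous_linear|exact: cvg_cst].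
have vuc : continuous (fun v : E => v - u0).
  by move=> v; apply: cvgB; [exact: cvg_id|exact: cvg_cst].
have Oc : continuous (fun v => O (v - u0)).
  by move=> v; apply: (@continuous_comp _ _ _ (fun v => v - u0) O); [exact: vuc|exact: continuous_linear].
have xc : continuous (fun _ : E => x) by move=> v; exact: cvg_cst.
have -> : q = fun v => k + dotp x (K v + e) + sigma / 2 * dotp (K v + e) (K v + e)
    + 2^-1 * dotp (v - u0) (O (v - u0)).
  by apply/funext => v; rewrite dotpp.
move=> v.
apply: cvgD; [apply: cvgD; [apply: cvgD; first exact: cvg_cst|]|].
- exact: (continuous_dotp xc Kec).
- by apply: cvgM; [exact: cvg_cst|exact: (continuous_dotp Kec Kec)].
- by apply: cvgM; [exact: cvg_cst|exact: (continuous_dotp vuc Oc)].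
Qed.

Let a_ge0 u : 0 <= a u.
Proof.
apply: addr_ge0; first by rewrite mulr_ge0 ?sqr_ge0// divr_ge0// ltW.
by rewrite mulr_ge0//; exact: hO.2.
Qed.

Let a_eq0 u : a u = 0 <-> K u = 0 /\ O u = 0.
Proof.
split=> [|[Ku Ou]]; last by rewrite /a Ku Ou normr0 dotp0r expr0n !mulr0 addr0.
have s2 : 0 < sigma / 2 by rewrite divr_gt0.
have h2 : 0 < 2^-1 :> R by rewrite invr_gt0.
rewrite /a => /eqP; rewrite paddr_eq0; last 2 first.
- by rewrite mulr_ge0 ?sqr_ge0// ltW.
- by rewrite mulr_ge0//; exact: hO.2.
rewrite (mulf_eq0 (sigma / 2)) (mulf_eq0 2^-1) (gt_eqF s2) (gt_eqF h2) expf_eq0 /=.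
rewrite normr_eq0 => /andP[/eqP Ku /eqP Ou].
by split=> //; exact: psd_form_eq0.
Qed.

(** Self-adjointness moves [O] onto [u], where it vanishes. *)
Let l_eq0 v u : a u = 0 -> l v u = 0.
Proof.
move=> /a_eq0[Ku Ou]; rewrite /l -(hO.1 u) Ku Ou dotp0r !(dotpC 0) !dotp0r.
by rewrite mulr0 !addr0.
Qed.

Let h v := (theta v + (q v)%:E)%E.

Let hh : closed_proper_convex h.
Proof. exact: quadratic_perturbation_closed_proper_convex qE a_ge0. Qed.

Let h_direction u :
  recession_direction h u <-> [/\ K u = 0, O u = 0 & (recession theta u <= 0)%E].
Proof.
have dE := quadratic_perturbation_recession hth qE a_ge0 l_eq0 u.
split=> [/dE[/a_eq0[Ku Ou] /(recession_le0P hth) ru]//|[Ku Ou ru]].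
by apply/dE; split; [exact/a_eq0|exact/(recession_le0P hth)].
Qed.

(** A recession direction of [h] in the constancy space of [theta] can be reversed; any other would
    be critical with nonpositive recession value, which [crit] excludes. *)
Lemma objective_solvable :
  (forall u, critical_directions theta K O u -> (0 < recession theta u)%E) ->
  minimizers h !=set0.
Proof.
move=> crit; apply: (minimizer_exists hh) => u /h_direction[Ku Ou ru].
have [[cN c0]|nu] := pselect (constancy_space theta u).
  by apply/h_direction; rewrite !linearN Ku Ou !oppr0 cN c0.
have /crit : critical_directions theta K O u by [].
by rewrite ltNge ru.
Qed.

Lemma objective_solvable_boundedP :
  minimizers h !=set0 /\ bounded_set (minimizers h) <->
  (forall u, u <> 0 -> K u = 0 -> O u = 0 -> (0 < recession theta u)%E).
Proof.
rewrite -(minimizers_boundedP hh); split=> [D0 u u0' Ku Ou|pos u].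
  by rewrite ltNge; apply/negP => ru; apply/u0'/D0/h_direction.
move=> /h_direction[Ku Ou ru]; apply: contrapT => /pos/(_ Ku Ou).
by rewrite ltNge ru.
Qed.

End augmented_objective.

(** * Application to the subproblems in [y] and [z] *)

Lemma op_seminorm_sqr (R : realType) (E : euclideanType R) (O : E -> E) (u : E) :
  self_adjoint_psd O -> op_seminorm O u ^+ 2 = dotp u (O u).
Proof. by move=> [_ Opos]; rewrite sqr_sqrtr. Qed.

Theorem proposition2p1 (R : realType) (X Y Z : euclideanType R)
    (f : Y -> \bar R) (g : Z -> \bar R)
    (hf : closed_proper_convex f) (hg : closed_proper_convex g)
    (A : {linear X -> Y}) (B : {linear X -> Z})
    (Aadj : {linear Y -> X}) (Badj : {linear Z -> X})
    (hA : adjoint_of A Aadj) (hB : adjoint_of B Badj)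
    (c : X) (sigma : R) (hsigma : 0 < sigma)
    (S : {linear Y -> Y}) (T : {linear Z -> Z})
    (hS : self_adjoint_psd S) (hT : self_adjoint_psd T)
    (x' : X) (y' : Y) (z' : Z) (hy' : edom f y') (hz' : edom g z') :
  let Py := objective_y f g Aadj Badj c sigma S x' y' z' in
  let Pz := objective_z f g Aadj Badj c sigma T x' y' z' in
  let M := critical_directions f Aadj S in
  let N := critical_directions g Badj T in
  (* (a) *)
  (((forall y, M y -> (0 < recession f y)%E) -> minimizers Py !=set0) /\
   ((forall z, N z -> (0 < recession g z)%E) -> minimizers Pz !=set0)) /\
  (* (b) *)
  ((minimizers Py !=set0 /\ bounded_set (minimizers Py) <->
     (forall y, y <> 0 -> Aadj y = 0 -> S y = 0 -> (0 < recession f y)%E)) /\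
   (minimizers Pz !=set0 /\ bounded_set (minimizers Pz) <->
     (forall z, z <> 0 -> Badj z = 0 -> T z = 0 -> (0 < recession g z)%E))).
Proof.
move=> Py Pz M N.
have [fy fyE] := edom_fin hf hy'; have [gz gzE] := edom_fin hg hz'.
(* The fixed variable contributes a finite value, by membership in the domain, and a constant shift
   of the residual. *)
pose qy y := gz + dotp x' (Aadj y + (Badj z' - c))
  + sigma / 2 * `|Aadj y + (Badj z' - c)| ^+ 2 + 2^-1 * dotp (y - y') (S (y - y')).
pose qz z := fy + dotp x' (Badj z + (Aadj y' - c))
  + sigma / 2 * `|Badj z + (Aadj y' - c)| ^+ 2 + 2^-1 * dotp (z - z') (T (z - z')).
have -> : Py = fun y => (f y + (qy y)%:E)%E.
  apply/funext => y; rewrite /Py /objective_y /aug_lagrangian gzE op_seminorm_sqr//.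
  by rewrite /qy [Aadj y + (_ - _)]addrA -!addeA -!EFinD !addrA.
have -> : Pz = fun z => (g z + (qz z)%:E)%E.
  apply/funext => z; rewrite /Pz /objective_z /aug_lagrangian fyE op_seminorm_sqr//.
  rewrite /qz [Badj z + (_ - _)]addrA [Badj z + _]addrC [(_%:E + g z)%E]addeC.
  by rewrite -!addeA -!EFinD !addrA.
split; split.
- exact: objective_solvable.
- exact: objective_solvable.
- exact: objective_solvable_boundedP.
- exact: objective_solvable_boundedP.
Qed.
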